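(* Let $n\ge 3$ be an integer, let $k$ be a nonnegative integer and let $\nu_1,\dots,\nu_n$ be real parameters. Let $\mathfrak{D}_{n-1}$ be the Lie algebra of differential operators in the $n-2$ variables $u_1,\dots,u_{n-2}$ (a realization of $\mathfrak{sl}_{n-1}(\mathbb{R})$ depending on the parameter $k$) defined in the context, and let $\mathcal{U}(\mathfrak{D}_{n-1})$ be the unital associative algebra of differential operators generated by $\mathfrak{D}_{n-1}$. Let $\widetilde{C_i}$ ($1\le i\le n$) and $\widetilde{C_{ij}}$ ($1\le i,j\le n$, $i\ne j$) be the differential operators in $u_1,\dots,u_{n-2}$ defined in the context, which realize the generators of the higher rank Racah algebra $\mathcal{R}_n$. Then all the operators $\widetilde{C_i}$ and $\widetilde{C_{ij}}$ belong to $\mathcal{U}(\mathfrak{D}_{n-1})$. Consequently, the algebra of differential operators generated by the $\widetilde{C_i}$ and $\widetilde{C_{ij}}$ (the differential operator realization of $\mathcal{R}_n$) is contained in $\mathcal{U}(\mathfrak{D}_{n-1})$.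
   Context: All operators are elements of the algebra of differential operators with real polynomial coefficients in the real variables $u_1,\dots,u_{n-2}$ (the Weyl algebra $\mathbb{R}[u_1,\dots,u_{n-2}]\langle \partial_{u_1},\dots,\partial_{u_{n-2}}\rangle$), and $\partial_\ell=\partial_{u_\ell}=\partial/\partial u_\ell$. Products are compositions, and real numbers are identified with scalar multiples of the identity. **The Lie algebra $\mathfrak{D}_{n-1}$.** Put $$\tilde{\mathbb{E}}:=\sum_{\ell=1}^{n-2}u_\ell\partial_\ell-k .$$ $\mathfrak{D}_{n-1}$ is the real Lie algebra (with the commutator as bracket) spanned by the operators - $T_{ij}:=-u_j\partial_i$ for $i\ne j$, $1\le i,j\le n-2$; - $T_{i,n-1}:=-\partial_i$ for $1\le i\le n-2$; - $T_{n-1,j}:=u_j\tilde{\mathbb{E}}$ for $1\le j\le n-2$; - $\tilde T_d:=-u_d\partial_d-\tilde{\mathbb{E}}$ for $1\le d\le n-2$. It is isomorphic to $\mathfrak{sl}_{n-1}(\mathbb{R})$ via $E_{ij}\mapsto T_{ij}$ ($i\neq j$) and $E_{dd}-E_{n-1,n-1}\mapsto\tilde T_d$, where $E_{ij}$ are the matrix units. Here $\mathcal{U}(\mathfrak{D}_{n-1})$ denotes the unital associative algebra of differential operators generated by $\mathfrak{D}_{n-1}$ inside the Weyl algebra (not the abstract universal enveloping algebra). **The Racah operators.** The higher rank Racah algebra $\mathcal{R}_n$ is the subalgebra of $\mathcal{U}(\mathfrak{su}(1,1))^{\otimes n}$ generated by the intermediate Casimir elements $C_A$, $\emptyset\ne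 A\subset\{1,\dots,n\}$; these satisfy $C_A=\sum_{\{i,j\}\subset A}C_{ij}-(|A|-2)\sum_{i\in A}C_i$, so $\mathcal{R}_n$ is generated by the $C_i$ and $C_{ij}$. A known differential operator realization $C_i\mapsto\widetilde{C_i}$, $C_{ij}\mapsto\widetilde{C_{ij}}$ of $\mathcal{R}_n$ on polynomials of degree $k$ in $n-2$ variables is as follows. Convention: whenever the index $n-1$ occurs, $u_{n-1}$ is absent, i.e. $u_{n-1}:=0$ and $\partial_{u_{n-1}}:=0$. Set $\widetilde{C_{ij}}=\widetilde{C_{ji}}$, and $$\widetilde{C_i}=\nu_i(\nu_i-1),\qquad 1\le i\le n,$$ $$\begin{aligned}\widetilde{C_{12}}=&-\Big(k-1-\sum_{\ell=1}^{n-2}u_\ell\partial_{u_\ell}\Big)\Big(-k-\partial_{u_1}+\sum_{\ell=1}^{n-2}u_\ell\partial_{u_\ell}\Big)+2\nu_2\Big(k-\sum_{\ell=1}^{n-2}u_\ell\partial_{u_\ell}\Big)\\&-2\nu_1\Big(-k-\partial_{u_1}+\sum_{\ell=1}^{n-2}u_\ell\partial_{u_\ell}\Big)+(\nu_1+\nu_2)(\nu_1+\nu_2-1),\end{aligned}$$ for $3\le j\le n$: $$\begin{aligned}\widetilde{C_{1j}}=&-\Big(1-\sum_{\ell=1}^{j-2}u_\ell\Big)^2\Big(k-1-\sum_{\ell=1}^{n-2}u_\ell\partial_{u_\ell}\Big)(\partial_{u_{j-2}}-\partial_{u_{j-1}})\\&+2\nu_j\Big(1-\sum_{\ell=1}^{j-2}u_\ell\Big)\Big(k-\sum_{\ell=1}^{n-2}u_\ell\partial_{u_\ell}\Big)-2\nu_1\Big(1-\sum_{\ell=1}^{j-2}u_\ell\Big)(\partial_{u_{j-2}}-\partial_{u_{j-1}})\\&+(\nu_1+\nu_j)(\nu_1+\nu_j-1),\end{aligned}$$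 $$\begin{aligned}\widetilde{C_{2j}}=&-\Big(\sum_{\ell=1}^{j-2}u_\ell\Big)^2\Big(1-k-\partial_{u_1}+\sum_{\ell=1}^{n-2}u_\ell\partial_{u_\ell}\Big)(\partial_{u_{j-2}}-\partial_{u_{j-1}})\\&+2\nu_j\Big(\sum_{\ell=1}^{j-2}u_\ell\Big)\Big(k+\partial_{u_1}-\sum_{\ell=1}^{n-2}u_\ell\partial_{u_\ell}\Big)+2\nu_2\Big(\sum_{\ell=1}^{j-2}u_\ell\Big)(\partial_{u_{j-2}}-\partial_{u_{j-1}})\\&+(\nu_2+\nu_j)(\nu_2+\nu_j-1),\end{aligned}$$ and for $3\le j<i\le n$: $$\begin{aligned}\widetilde{C_{ij}}=&-\Big(\sum_{\ell=j-1}^{i-2}u_\ell\Big)^2(\partial_{u_{i-2}}-\partial_{u_{i-1}})(\partial_{u_{j-2}}-\partial_{u_{j-1}})\\&+2\nu_j\Big(\sum_{\ell=j-1}^{i-2}u_\ell\Big)(\partial_{u_{i-2}}-\partial_{u_{i-1}})-2\nu_i\Big(\sum_{\ell=j-1}^{i-2}u_\ell\Big)(\partial_{u_{j-2}}-\partial_{u_{j-1}})\\&+(\nu_i+\nu_j)(\nu_i+\nu_j-1).\end{aligned}$$ *)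

(* Defs.v *)
From HB Require Import structures.
From mathcomp Require Import all_boot all_order all_algebra.
From mathcomp Require Import boolp classical_sets reals.
From mathcomp Require Import mpoly.

Set Implicit Arguments.
Unset Strict Implicit.
Unset Printing Implicit Defensive.

Import GRing.Theory.

Local Open Scope ring_scope.
Local Open Scope classical_set_scope.

(* Differential operators are taken as operators on polynomials.  In
   characteristic 0 the Weyl algebra acts faithfully on the polynomial ring, so
   it is the subalgebra of [op K m] generated by multiplications by polynomials
   and partial derivatives.  The product of [op K m] is composition,
   (f * g) p = f (g p). *)
Section OperatorAlgebra.
Variables (K : comNzRingType) (m : nat).
Local Notation P := {mpoly K[m]}.

Definition op : Type := {linear P -> P}.

Implicit Types (f g h : op) (a b : K).

Lemma opP f g : (forall p, f p = g p) -> f = g.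
Proof.
case: f g => [f cf] [g cg] fg.
have {}fg : f = g by apply: funext => p; exact: fg p.
subst g; congr GRing.Linear.Pack.
case: cf cg => [[p] [q]] [[p'] [q']].
by rewrite (Prop_irrelevance p p') (Prop_irrelevance q q').
Qed.

HB.instance Definition _ := gen_eqMixin op.
HB.instance Definition _ := gen_choiceMixin op.

Definition op_zero : op := (\0 : P -> P) : {linear P -> P}.
Definition op_add f g : op := (f \+ g : P -> P) : {linear P -> P}.
Definition op_opp f : op := (\- f : P -> P) : {linear P -> P}.
Definition op_one : op := (idfun : P -> P) : {linear P -> P}.
Definition op_mul f g : op := (f \o g : P -> P) : {linear P -> P}.
Definition op_scale a f : op := (a \*: f : P -> P) : {linear P -> P}.

Fact op_addA : associative op_add.
Proof. by move=> f g h; apply: opP => p /=; rewrite addrA. Qed.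
Fact op_addC : commutative op_add.
Proof. by move=> f g; apply: opP => p /=; rewrite addrC. Qed.
Fact op_add0 : left_id op_zero op_add.
Proof. by move=> f; apply: opP => p /=; rewrite add0r. Qed.
Fact op_addN : left_inverse op_zero op_opp op_add.
Proof. by move=> f; apply: opP => p /=; rewrite addNr. Qed.

HB.instance Definition _ :=
  GRing.isZmodule.Build op op_addA op_addC op_add0 op_addN.

Fact op_mulA : associative op_mul.
Proof. by move=> f g h; apply: opP. Qed.
Fact op_mul1 : left_id op_one op_mul.
Proof. by move=> f; apply: opP. Qed.
Fact op_mulr1 : right_id op_one op_mul.
Proof. by move=> f; apply: opP. Qed.
Fact op_mulDl : left_distributive op_mul +%R.
Proof. by move=> f g h; apply: opP. Qed.
Fact op_mulDr : right_distributive op_mul +%R.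
Proof. by move=> f g h; apply: opP => p; exact: linearD. Qed.
Fact op_one_neq0 : op_one != 0.
Proof.
by apply/eqP=> /(congr1 (fun f : op => f 1)) /= /eqP; rewrite oner_eq0.
Qed.

HB.instance Definition _ := GRing.Zmodule_isNzRing.Build op
  op_mulA op_mul1 op_mulr1 op_mulDl op_mulDr op_one_neq0.

Fact op_scaleA a b f : op_scale a (op_scale b f) = op_scale (a * b) f.
Proof. by apply: opP => p; exact: scalerA. Qed.
Fact op_scale1 : left_id 1 op_scale.
Proof. by move=> f; apply: opP => p; exact: scale1r. Qed.
Fact op_scaleDr : right_distributive op_scale +%R.
Proof. by move=> a f g; apply: opP => p; exact: scalerDr. Qed.
Fact op_scaleDl f : {morph op_scale^~ f : a b / a + b}.
Proof. by move=> a b; apply: opP => p; exact: scalerDl. Qed.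

HB.instance Definition _ := GRing.Zmodule_isLmodule.Build K op
  op_scaleA op_scale1 op_scaleDr op_scaleDl.

Fact op_scaleAl a f g : a *: (f * g) = a *: f * g.
Proof. by apply: opP. Qed.
HB.instance Definition _ := GRing.Lmodule_isLalgebra.Build K op op_scaleAl.

Fact op_scaleAr a f g : a *: (f * g) = f * (a *: g).
Proof. by apply: opP => p; symmetry; exact: linearZ. Qed.
HB.instance Definition _ := GRing.Lalgebra_isAlgebra.Build K op op_scaleAr.

Definition mulX_op (i : 'I_m) : op := ('X_i \*o idfun : P -> P) : {linear P -> P}.
Definition deriv_op (i : 'I_m) : op := mderiv i : {linear P -> P}.

(* Variables are numbered 1, ..., m; outside this range u_l and d/du_l are 0. *)
Definition u (l : nat) : op :=
  if l is l'.+1 then oapp mulX_op 0 (insub l') else 0.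
Definition du (l : nat) : op :=
  if l is l'.+1 then oapp deriv_op 0 (insub l') else 0.

End OperatorAlgebra.

Definition span (K : pzRingType) (V : lmodType K) (S : set V) : set V :=
  smallest (fun B : set V => GRing.submod_closed (mem B)) S.

Definition gen_alg (K : pzRingType) (A : lalgType K) (S : set A) : set A :=
  smallest (fun B : set A => GRing.subalg_closed (mem B)) S.

Section LieAlgebra.
Variables (R : realType) (n k : nat).

Local Notation D := (op R (n - 2)).
Local Notation u := (@u R (n - 2)).
Local Notation du := (@du R (n - 2)).

Definition euler : D := \sum_(1 <= l < (n - 2).+1) u l * du l.

Definition eulerk : D := euler - k%:R%:A.

(* Under the isomorphism with sl_{n-1}, the constructors are the images of
   E_ij, E_{i,n-1}, E_{n-1,j} and E_dd - E_{n-1,n-1}. *)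
Inductive lie_gen : set D :=
| Lie_T_ij i j of (1 <= i <= n - 2)%N & (1 <= j <= n - 2)%N & i != j :
    lie_gen (- (u j * du i))
| Lie_T_in i of (1 <= i <= n - 2)%N : lie_gen (- du i)
| Lie_T_nj j of (1 <= j <= n - 2)%N : lie_gen (u j * eulerk)
| Lie_T_d d of (1 <= d <= n - 2)%N : lie_gen (- (u d * du d) - eulerk).

Definition lieD : set D := span lie_gen.

(* U(D_{n-1}) as an algebra of differential operators, not the abstract
   universal enveloping algebra. *)
Definition lieD_alg : set D := gen_alg lieD.

End LieAlgebra.

Arguments euler {R n}.
Arguments eulerk {R n}.
Arguments lieD {R} n k.
Arguments lieD_alg {R} n k.

(* The parameters nu_1, ..., nu_n are the values of nu : nat -> R at 1, ..., n;
   the other values are not used. *)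
Section RacahOperators.
Variables (R : realType) (n k : nat) (nu : nat -> R).

Local Notation D := (op R (n - 2)).
Local Notation u := (@u R (n - 2)).
Local Notation du := (@du R (n - 2)).
Local Notation E := (@euler R n).
Local Notation kk := (k%:R%:A : D).

Definition usum (a b : nat) : D := \sum_(a <= l < b.+1) u l.

Definition casimir1 (i : nat) : D := (nu i * (nu i - 1))%:A.

Definition cst2 (i j : nat) : D := ((nu i + nu j) * (nu i + nu j - 1))%:A.

Definition casimir_12 : D :=
  - ((kk - 1 - E) * (- kk - du 1%N + E))
  + (2 * nu 2%N) *: (kk - E)
  - (2 * nu 1%N) *: (- kk - du 1%N + E)
  + cst2 1%N 2%N.

(* For 3 <= j; the term du (j - 1) vanishes when j = n. *)
Definition casimir_1j (j : nat) : D :=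
  let S := 1 - usum 1%N (j - 2)%N in
  let d := du (j - 2)%N - du (j - 1)%N in
  - (S ^+ 2 * (kk - 1 - E) * d)
  + (2 * nu j) *: (S * (kk - E))
  - (2 * nu 1%N) *: (S * d)
  + cst2 1%N j.

(* For 3 <= j. *)
Definition casimir_2j (j : nat) : D :=
  let S := usum 1%N (j - 2)%N in
  let d := du (j - 2)%N - du (j - 1)%N in
  - (S ^+ 2 * (1 - kk - du 1%N + E) * d)
  + (2 * nu j) *: (S * (kk + du 1%N - E))
  + (2 * nu 2%N) *: (S * d)
  + cst2 2%N j.

(* For 3 <= j < i; the term du (i - 1) vanishes when i = n. *)
Definition casimir_ij (i j : nat) : D :=
  let S := usum (j - 1)%N (i - 2)%N in
  let di := du (i - 2)%N - du (i - 1)%N in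
  let dj := du (j - 2)%N - du (j - 1)%N in
  - (S ^+ 2 * di * dj)
  + (2 * nu j) *: (S * di)
  - (2 * nu i) *: (S * dj)
  + cst2 i j.

Definition casimir2_lt (a b : nat) : D :=
  if a == 1%N then (if b == 2%N then casimir_12 else casimir_1j b)
  else if a == 2%N then casimir_2j b
  else casimir_ij b a.

Definition casimir2 (i j : nat) : D := casimir2_lt (minn i j) (maxn i j).

Inductive racah_gen : set D :=
| Racah_C_i i of (1 <= i <= n)%N : racah_gen (casimir1 i)
| Racah_C_ij i j of (1 <= i <= n)%N & (1 <= j <= n)%N & i != j :
    racah_gen (casimir2 i j).

Definition racah_alg : set D := gen_alg racah_gen.

End RacahOperators.

Arguments casimir1 {R} n nu i.
Arguments casimir2 {R} n k nu i j.
Arguments racah_alg {R} n k nu.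

(* Main.v *)
(* The Cartan generators of the Lie algebra sum to -(E + m H), where E is the
   Euler operator, H = E - k and m = n - 2; as m + 1 is invertible, H itself and
   then every u_j d_i lie in U.  The only obstruction left in the Racah
   operators is a factor S ^ 2 with S affine in the u_l.  The commutator of a
   constant coefficient derivation d with S is a scalar c, and d H = (H + 1) d,
   so S ^ 2 (H + 1) d = (S d) (S H) - c (S H), where S d and S H are in U; the
   factors H + 1 - d_1 and d' are handled in the same way. *)
Require Import Defs.
From HB Require Import structures.
From mathcomp Require Import all_boot all_order all_algebra.
From mathcomp Require Import boolp classical_sets reals.
From mathcomp Require Import mpoly.

Set Implicit Arguments.
Unset Strict Implicit.
Unset Printing Implicit Defensive.

Import GRing.Theory Num.Theory.

Local Open Scope ring_scope.
Local Open Scope classical_set_scope.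

(** * Generated subalgebras *)

Section GenAlg.
Variables (K : pzRingType) (A : lalgType K) (S : set A).

(** Boolean form of [gen_alg S], to which a closure instance can be attached so that the [rpred]
    lemmas apply. *)
Definition gen_alg_pred : {pred A} := mem (gen_alg S).

Lemma gen_algE x : (x \in gen_alg_pred) = `[< gen_alg S x >].
Proof. by []. Qed.

Lemma gen_alg_subalg_closed : GRing.subalg_closed gen_alg_pred.
Proof.
split=> [|a x y|x y].
- by apply/asboolP => B [[B1 _ _] _]; have := B1; rewrite inE.
- rewrite !gen_algE => /asboolP Sx /asboolP Sy; apply/asboolP => B BS.
  have [[_ BL _] _] := BS; have := BL a x y.
  by rewrite !inE; apply; [apply: Sx|apply: Sy].
- rewrite !gen_algE => /asboolP Sx /asboolP Sy; apply/asboolP => B BS.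
  have [[_ _ BM] _] := BS; have := BM x y.
  by rewrite !inE; apply; [apply: Sx|apply: Sy].
Qed.

HB.instance Definition _ :=
  GRing.isSubalgClosed.Build K A gen_alg_pred gen_alg_subalg_closed.

Lemma gen_alg_scalar (a : K) : a%:A \in gen_alg_pred.
Proof. by rewrite rpredZ ?rpred1. Qed.

End GenAlg.

(** * Commutation relations in the Weyl algebra *)

Section Weyl.
Variables (K : comNzRingType) (m : nat).
Local Notation u := (@u K m).
Local Notation du := (@du K m).

Lemma du_out i : ~~ (1 <= i <= m)%N -> du i = 0.
Proof. by case: i => [|i] //= im; rewrite insubF //; apply/negbTE. Qed.

Lemma u_out i : ~~ (1 <= i <= m)%N -> u i = 0.
Proof. by case: i => [|i] //= im; rewrite insubF //; apply/negbTE. Qed.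

Lemma du_comm i j : du i * du j = du j * du i.
Proof.
case: (boolP (1 <= i <= m)%N) => [|/du_out->]; last by rewrite mul0r mulr0.
case: (boolP (1 <= j <= m)%N) => [|/du_out->]; last by rewrite mul0r mulr0.
case: i j => [|i] [|j] //= jm im; rewrite !insubT /=.
by apply: opP => p /=; exact: mderiv_comm.
Qed.

(** Canonical commutation relation; the range test reflects the zero convention outside 1, ...,
    m. *)
Lemma du_u i j :
  du i * u j = u j * du i + ((i == j) && (1 <= i <= m)%N)%:R%:A.
Proof.
case: (boolP (1 <= i <= m)%N) => [|/du_out->]; last first.
  by rewrite mul0r mulr0 andbF scale0r addr0.
case: (boolP (1 <= j <= m)%N) => [|/[dup] jm /u_out->]; last first.
  move=> im; case: eqVneq im jm => [->-> //|_ _ _].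
  by rewrite mul0r mulr0 scale0r addr0.
case: i j => [|i] [|j] //= jm im; rewrite !insubT /= andbT eqSS.
apply: opP => p /=.
rewrite mderivM mderivX mnm1E addrC; congr (_ + _).
rewrite -(inj_eq val_inj) /= eq_sym.
case: eqVneq => [ij|_]; last by rewrite !scale0r mul0r.
have -> : Sub j jm = Sub i im :> 'I_m by apply: val_inj.
by rewrite -{1}[U_(_)%MM]add0m addmK mpolyX0 !scale1r mul1r.
Qed.

Lemma du_usum i a b :
  exists c : K,
    du i * \sum_(a <= l < b) u l = (\sum_(a <= l < b) u l) * du i + c%:A.
Proof.
exists (\sum_(a <= l < b) ((i == l) && (1 <= i <= m)%N)%:R).
rewrite mulr_sumr mulr_suml scaler_suml -big_split /=.
by apply: eq_bigr => l _; rewrite du_u.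
Qed.

End Weyl.

(** * The Euler operator and first elements of [U] *)

Section LieD.
Variables (R : realType) (n k : nat).

Local Notation D := (op R (n - 2)).
Local Notation u := (@u R (n - 2)).
Local Notation du := (@du R (n - 2)).
Local Notation E := (@euler R n).
Local Notation H := (@eulerk R n k).
Local Notation U := (gen_alg_pred (@lieD R n k)).

Lemma du_euler i : du i * E = E * du i + du i.
Proof.
rewrite /euler mulr_sumr mulr_suml.
have [im|im] := boolP (1 <= i <= n - 2)%N; last first.
  by rewrite du_out // addr0; apply: eq_bigr => l _; rewrite mul0r mulr0.
(* Kronecker coefficients spread d_i over the Euler sum, so the identity can be checked term by
   term. *)
have dui : du i = \sum_(1 <= l < (n - 2).+1) (i == l)%:R *: du l.
  rewrite (bigD1_seq i) ?mem_index_iota ?iota_uniq //=.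
  rewrite eqxx scale1r big1 ?addr0 // => l /negbTE il.
  by rewrite eq_sym il scale0r.
rewrite [X in _ = _ + X]dui -big_split /=; apply: eq_bigr => l _.
by rewrite mulrA du_u im andbT mulrDl -!mulrA du_comm -scalerAl mul1r.
Qed.

Lemma du_eulerk i : du i * H = (H + 1) * du i.
Proof.
rewrite /eulerk mulrBr mulrDl mulrBl du_euler mul1r addrAC.
by rewrite -scalerAr -scalerAl mulr1 mul1r.
Qed.

Lemma lie_gen_U x : lie_gen k x -> x \in U.
Proof.
by move=> lx; rewrite gen_algE; apply/asboolP; do 2!apply: sub_gen_smallest.
Qed.

Lemma du_U i : du i \in U.
Proof.
have [im|/du_out->] := boolP (1 <= i <= n - 2)%N; last exact: rpred0.
by rewrite -rpredN; apply: lie_gen_U; exact: Lie_T_in.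
Qed.

Lemma u_eulerk_U j : u j * H \in U.
Proof.
have [jm|/u_out->] := boolP (1 <= j <= n - 2)%N; last by rewrite mul0r rpred0.
by apply: lie_gen_U; exact: Lie_T_nj.
Qed.

Lemma eulerk_U : H \in U.
Proof.
have : \sum_(1 <= d < (n - 2).+1) (- (u d * du d) - H) \in U.
  rewrite big_nat_cond; apply: rpred_sum => d; rewrite andbT ltnS => dm.
  by apply: lie_gen_U; exact: Lie_T_d.
rewrite big_split /= !sumrN sumr_const_nat subn1 /= -opprD rpredN.
(* Substituting E = H + k turns E + (n - 2) H into (n - 1) H + k. *)
rewrite -[X in X + _]/E -[X in X + _](subrK (k%:R%:A)) -/H addrAC -mulrS.
rewrite rpredDr ?gen_alg_scalar // -scaler_nat => /(rpredZ (n - 2).+1%:R^-1).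
by rewrite scalerA mulVf ?scale1r // pnatr_eq0.
Qed.

Lemma euler_U : E \in U.
Proof. by have := eulerk_U; rewrite rpredBr ?gen_alg_scalar. Qed.

Lemma u_du_U j i : u j * du i \in U.
Proof.
have [im|/du_out->] := boolP (1 <= i <= n - 2)%N; last by rewrite mulr0 rpred0.
have [jm|/u_out->] := boolP (1 <= j <= n - 2)%N; last by rewrite mul0r rpred0.
rewrite -rpredN; case: (eqVneq i j) => [<-|ij]; last first.
  by apply: lie_gen_U; exact: Lie_T_ij.
(* The diagonal operator differs from a Cartan generator by [H]. *)
by rewrite -(rpredBr _ eulerk_U); apply: lie_gen_U; exact: Lie_T_d.
Qed.

Lemma usum_du_U a b i : usum R n a b * du i \in U.
Proof. by rewrite mulr_suml; apply: rpred_sum => l _; exact: u_du_U. Qed.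

Lemma usum_eulerk_U a b : usum R n a b * H \in U.
Proof. by rewrite mulr_suml; apply: rpred_sum => l _; exact: u_eulerk_U. Qed.

(** Moving d past the second S gives (S d)(S X) = S^2 d X + c S X, so S^2 is absorbed without S
    itself having to lie in [U]. *)
Lemma sqr_mul_U (S d X : D) (c : R) : d * S = S * d + c%:A ->
  S * d \in U -> S * X \in U -> S ^+ 2 * (d * X) \in U.
Proof.
move=> dS Sd SX.
have -> : S ^+ 2 * (d * X) = (S * d) * (S * X) - c *: (S * X).
  have -> : c *: (S * X) = S * (c%:A * X) by rewrite -scalerAl mul1r scalerAr.
  by rewrite -mulrA (mulrA d S) dS mulrDl mulrDr addrK expr2 !mulrA.
by apply: rpredB; [exact: rpredM|exact: rpredZ].
Qed.

Lemma quadratic_form_U (X Y Z : D) (a b c : R) :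
  X \in U -> Y \in U -> Z \in U ->
  - X + a *: Y + b *: Z + c%:A \in U.
Proof.
move=> XU YU ZU; apply: rpredD; last exact: gen_alg_scalar.
by apply: rpredD; [apply: rpredD; [rewrite rpredN|]|]; rewrite ?rpredZ.
Qed.

(** * Membership of the Racah operators *)

Variable nu : nat -> R.

(** Provides the commutation hypothesis of [sqr_mul_U]; out-of-range derivatives are zero, so the
    boundary index n - 1 is covered too. *)
Lemma dudiff_usum i j a b : exists c : R,
  (du i - du j) * usum R n a b = usum R n a b * (du i - du j) + c%:A.
Proof.
have [c ic] := du_usum R (n - 2) i a b.+1.
have [e je] := du_usum R (n - 2) j a b.+1.
exists (c - e); rewrite mulrBl ic je mulrBr scalerBl opprD addrACA.
by [].
Qed.

Lemma dudiff_eulerk i j : (du i - du j) * H = (H + 1) * (du i - du j).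
Proof. by rewrite mulrBl !du_eulerk -mulrBr. Qed.

Lemma usum_dudiff_U a b i j : usum R n a b * (du i - du j) \in U.
Proof. by rewrite mulrBr rpredB ?usum_du_U. Qed.

(** No factor S occurs: this is a polynomial in E, d_1 and scalars. *)
Lemma casimir_12_U : casimir_12 n k nu \in U.
Proof.
by rewrite /casimir_12 !(rpredD, rpredN, rpredM, rpredZ, rpred1,
  gen_alg_scalar, euler_U, du_U).
Qed.

Lemma casimir_1j_U j : casimir_1j n k nu j \in U.
Proof.
rewrite /casimir_1j; set S := usum _ _ _ _; set d := du _ - du _.
have kE : k%:R%:A - E = - H by rewrite opprB.
have Sd : (1 - S) * d \in U.
  by rewrite mulrBl mul1r !rpredB ?usum_dudiff_U ?du_U.
have SH : (1 - S) * H \in U.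
  by rewrite mulrBl mul1r rpredB ?usum_eulerk_U ?eulerk_U.
have [c dS] := dudiff_usum (j - 2) (j - 1) 1 (j - 2).
have dS' : d * (1 - S) = (1 - S) * d + (- c)%:A.
  by rewrite mulrBr [(1 - S) * d]mulrBl mulr1 mul1r dS opprD addrA scaleNr.
(* Since k - 1 - E = -(H + 1), moving d to the left removes the shift by 1; [sqr_mul_U] then applies
   with X = H. *)
have kd : (k%:R%:A - 1 - E) * d = - (d * H).
  by rewrite dudiff_eulerk addrAC kE -opprD mulNr.
rewrite -mulrA kd kE -scaleNr; apply: quadratic_form_U => //.
- by rewrite mulrN rpredN; exact: sqr_mul_U dS' Sd SH.
- by rewrite mulrN rpredN.
Qed.

Lemma casimir_2j_U j : casimir_2j n k nu j \in U.
Proof.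
rewrite /casimir_2j; set S := usum _ _ _ _; set d := du _ - du _.
have Sd : S * d \in U by exact: usum_dudiff_U.
have SX : S * (H - du 1%N) \in U.
  by rewrite mulrBr rpredB ?usum_eulerk_U ?usum_du_U.
have [c dS] := dudiff_usum (j - 2) (j - 1) 1 (j - 2).
(* The left factor is H + 1 - d_1, and d commutes with d_1; here X = H - d_1. *)
have kd : (1 - k%:R%:A - du 1%N + E) * d = d * (H - du 1%N).
  have d1 : d * du 1%N = du 1%N * d.
    by rewrite mulrBr mulrBl; congr (_ - _); exact: du_comm.
  rewrite [RHS]mulrBr d1 dudiff_eulerk -mulrBl /eulerk addrC !addrA.
  by congr ((_ - _) * _); rewrite addrAC.
have -> : k%:R%:A + du 1%N - E = - (H - du 1%N).
  by rewrite !opprB addrA (addrC (du _)).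
rewrite -mulrA kd; apply: quadratic_form_U => //.
- exact: sqr_mul_U dS Sd SX.
- by rewrite mulrN rpredN.
Qed.

Lemma casimir_ij_U i j : casimir_ij n nu i j \in U.
Proof.
rewrite /casimir_ij.
have [c dS] := dudiff_usum (i - 2) (i - 1) (j - 1) (i - 2).
rewrite -mulrA -scaleNr; apply: quadratic_form_U; try exact: usum_dudiff_U.
(* Here X is the second difference of derivatives. *)
by apply: sqr_mul_U dS _ _; exact: usum_dudiff_U.
Qed.

Lemma casimir2_U i j : casimir2 n k nu i j \in U.
Proof.
rewrite /casimir2 /casimir2_lt.
case: ifP => _; last first.
  by case: ifP => _; [exact: casimir_2j_U|exact: casimir_ij_U].
by case: ifP => _; [exact: casimir_12_U|exact: casimir_1j_U].
Qed.

End LieD.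

Theorem mainTheorem1 (R : realType) (n : nat) (hn : (3 <= n)%N) (k : nat)
    (nu : nat -> R) :
  [/\ forall i : nat, (1 <= i <= n)%N -> lieD_alg n k (casimir1 n nu i),
      forall i j : nat, (1 <= i <= n)%N -> (1 <= j <= n)%N -> i != j ->
        lieD_alg n k (casimir2 n k nu i j)
    & racah_alg n k nu `<=` lieD_alg n k].
Proof.
have C1 i : lieD_alg n k (casimir1 n nu i).
  by apply/asboolP; exact: (gen_alg_scalar (@lieD R n k)).
have C2 i j : lieD_alg n k (casimir2 n k nu i j).
  by apply/asboolP; exact: casimir2_U.
split=> [i _|i j _ _ _|] //.
(* By minimality of the generated algebra, only its generators have to be checked. *)
apply: smallest_sub; first exact: (gen_alg_subalg_closed (@lieD R n k)).
by move=> _ [].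
Qed.
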